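(* For the finite-horizon inventory control problem described in the context, the functions $v_{t,\alpha}(x)$ and $G_{t,\alpha}(x)$, $t=0,1,\ldots$, are continuous on $\mathbb X$ for all $\alpha\ge0$.
   Context: Inventory model. $(\mathbb X,\mathbb A)$ is either $(\mathbb R,[0,+\infty))$ or $(\mathbb Z,\mathbb N_0)$ with $\mathbb N_0=\{0,1,2,\ldots\}$. Parameters: a fixed ordering cost $K>0$; a unit ordering cost $\bar c>0$; a convex function $h:\mathbb X\to[0,+\infty)$ with $h(0)=0$ and $h(x)\to\infty$ as $|x|\to\infty$ (on $\mathbb Z$, the convexity inequality is required whenever all points involved lie in $\mathbb Z$); i.i.d. nonnegative finite random variables $D_1,D_2,\ldots$ (integer-valued if $\mathbb X=\mathbb Z$), with $D$ denoting a random variable with the same distribution as $D_1$, $\mathbb E[D]<+\infty$, $\mathbb P(D>0)>0$, and $\mathbb E[h(x-D)]<+\infty$ for all $x\in\mathbb X$; a discount factor $\alpha\ge0$. Dynamics: $x_{t+1}=x_t+a_t-D_{t+1}$, $t=0,1,\ldots$, where $x_t\in\mathbb X$ is the inventory level and $a_t\in\mathbb A$ the ordered amount. One-step cost: $c(x,a)=K I_{\{a>0\}}+\bar c a+\mathbb E[h(x+a-D)]$. Policies are (possibly randomized, history-dependent) sequences $\pi=(\pi_0,\pi_1,\ldots)$ of decision rules, $\pi_t$ being a regular transition probability from histories $(x_0,a_0,\ldots,a_{t-1},x_t)$ to $\mathbb A$. For $N=0,1,\ldots$ let $v^\pi_{N,\alpha}(x)=\mathbb E^\pi_x\left[\sum_{t=0}^{N-1}\alpha^tc(x_t,a_t)\right]$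 and $v_{N,\alpha}(x)=\inf_\pi v^\pi_{N,\alpha}(x)$ (so $v_{0,\alpha}=0$). For $t=0,1,\ldots$: $G_{t,\alpha}(x):=\bar c x+\mathbb E[h(x-D)]+\alpha\mathbb E[v_{t,\alpha}(x-D)]$, and the optimality equation $v_{t+1,\alpha}(x)=\min_{a\in\mathbb A}\{K I_{\{a>0\}}+G_{t,\alpha}(x+a)\}-\bar c x$ holds (known fact). *)

(* Defs.v *)
From HB Require Import structures.
From mathcomp Require Import all_boot all_order all_algebra.
From mathcomp Require Import all_classical all_reals all_analysis.
From mathcomp Require Import measurable_realfun.

Set Implicit Arguments.
Unset Strict Implicit.
Unset Printing Implicit Defensive.

Import Order.TTheory GRing.Theory Num.Theory.
Import numFieldNormedType.Exports.

Local Open Scope classical_set_scope.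
Local Open Scope ring_scope.
Local Open Scope ereal_scope.

Section iid.
Context d (T : measurableType d) (R : realType) (P : probability T R).

Definition mutually_independent (X : nat -> {RV P >-> R}) : Prop :=
  forall (I : seq nat) (B : nat -> set R), uniq I ->
    (forall i, measurable (B i)) ->
    P (\bigcap_(i in [set` I]) (X i @^-1` B i)) =
    \prod_(i <- I) P (X i @^-1` B i).

Definition identically_distributed (X : nat -> {RV P >-> R}) : Prop :=
  forall n (B : set R), measurable B ->
    distribution P (X n) B = distribution P (X 0%N) B.

Definition iid (X : nat -> {RV P >-> R}) : Prop :=
  mutually_independent X /\ identically_distributed X.

End iid.

Section mbind.
Context d d' (X : measurableType d) (Y : measurableType d') (R : realType).
Variables (m : {measure set X -> \bar R}) (k : R.-ker X ~> Y).

Definition mbind (U : set Y) : \bar R := \int[m]_x k x U.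

Let mbind0 : mbind set0 = 0.
Proof. by rewrite /mbind integral0_eq// => x _; rewrite measure0. Qed.

Let mbind_ge0 U : 0 <= mbind U. Proof. exact: integral_ge0. Qed.

Let mbind_sigma_additive : semi_sigma_additive mbind.
Proof.
move=> U mU tU mUU; rewrite [X in _ --> X](_ : _ =
  \int[m]_x (\sum_(n <oo) k x (U n))); last first.
  apply: eq_integral => x _.
  by apply/esym/cvg_lim => //; exact/measure_semi_sigma_additive.
apply/cvg_closeP; split.
  by apply: is_cvg_nneseries => n _ _; exact: integral_ge0.
rewrite closeE// integral_nneseries// => n.
exact: measurable_kernel.
Qed.

HB.instance Definition _ := isMeasure.Build _ _ _ mbind
  mbind0 mbind_ge0 mbind_sigma_additive.

End mbind.

(* The two versions of the model; in both, inventory levels, ordered amounts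
   and demands are represented by elements of R. *)
Variant version := RealVersion | IntegerVersion.

Definition levels (R : realType) (s : version) : set R :=
  match s with
  | RealVersion => [set: R]
  | IntegerVersion => range (intr : int -> R)
  end.

Definition orders (R : realType) (s : version) : set R :=
  match s with
  | RealVersion => [set a | (0 <= a)%R]
  | IntegerVersion => range (fun n : nat => n%:R : R)
  end.

Definition convex_on (R : realType) (X : set R) (h : R -> R) : Prop :=
  forall x y l : R, X x -> X y -> (0 <= l <= 1)%R ->
    X (l * x + (1 - l) * y)%R ->
    (h (l * x + (1 - l) * y) <= l * h x + (1 - l) * h y)%R.

Section histories.
Context (R : realType).

Fixpoint hist_display (t : nat) : measure_display :=
  if t is u.+1 then
    measure_prod_display (measure_prod_display
      (hist_display u, default_measure_display), default_measure_display)
  else default_measure_display.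

(* Histories (x_0, a_0, x_1, ..., a_(t-1), x_t), as left-nested pairs. *)
Fixpoint hist (t : nat) : measurableType (hist_display t) :=
  match t return measurableType (hist_display t) with
  | 0 => R
  | u.+1 => (hist u * R * R)%type
  end.

Definition level (t : nat) : hist t -> R :=
  match t return hist t -> R with
  | 0 => fun x => x
  | u.+1 => fun y => y.2
  end.

Lemma measurable_level t : measurable_fun [set: hist t] (@level t).
Proof. by case: t => [|t] /=; [exact: measurable_id|exact: measurable_snd]. Qed.

Definition next_hist (t : nat) (y : hist t * R * R) : hist t.+1 :=
  (y.1.1, y.1.2, (level y.1.1 + y.1.2 - y.2)%R).

Lemma measurable_next_hist t : measurable_fun [set: hist t * R * R] (@next_hist t).
Proof.
have m1 : measurable_fun [set: hist t * R * R] (fun y => y.1.1).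
  exact: measurableT_comp.
have m2 : measurable_fun [set: hist t * R * R] (fun y => y.1.2).
  exact: measurableT_comp.
apply/measurable_fun_pair; first exact: measurable_fun_pair.
apply: measurable_funB => //; apply: measurable_funD => //.
exact: measurableT_comp (@measurable_level t) m1.
Qed.

End histories.

Record policy (R : realType) (s : version) := Policy {
  rule : forall t, R.-pker (hist R t) ~> R ;
  rule_orders : forall t y, rule t y (orders s) = 1
}.

Section inventory.
Context d (T : measurableType d) (R : realType) (P : probability T R).
(* D t is the demand D_(t+1) of the dynamics; D 0, i.e. D_1, also serves as
   the generic demand D. *)
Variables (s : version) (K c : R) (h : R -> R) (D : nat -> {RV P >-> R}).

Definition demand_law t : pprobability R R := distribution P (D t).

Definition transition t : R.-sfker (hist R t * R) ~> hist R t.+1 :=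
  kprobability (measurable_cst (demand_law t)) \; kdirac (@measurable_next_hist R t).

(* The strategic measure of pi and x_0 = x, on histories up to x_t. *)
Fixpoint strategic (pi : policy R s) (x : R) (t : nat) :
    {measure set (hist R t) -> \bar R} :=
  match t return {measure set (hist R t) -> \bar R} with
  | 0 => dirac x
  | u.+1 => mbind (strategic pi x u) (rule pi u \; transition u)
  end.

Definition one_step_cost (x a : R) : \bar R :=
  (K * (0 < a)%R%:R + c * a)%:E + 'E_P[fun w => h (x + a - D 0%N w)%R].

(* The sum of alpha^t c(x_t, a_t) over t < N. *)
Fixpoint total_cost (alpha : R) (N : nat) : hist R N -> \bar R :=
  match N return hist R N -> \bar R with
  | 0 => fun=> 0
  | t.+1 => fun y => total_cost alpha y.1.1 +
      (alpha ^+ t)%:E * one_step_cost (level y.1.1) y.1.2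
  end.

Definition policy_value (pi : policy R s) (N : nat) (alpha x : R) : \bar R :=
  \int[strategic pi x N]_y total_cost alpha y.

Definition value (N : nat) (alpha x : R) : \bar R :=
  ereal_inf [set policy_value pi N alpha x | pi in [set: policy R s]].

Definition G (t : nat) (alpha x : R) : \bar R :=
  (c * x)%:E + 'E_P[fun w => h (x - D 0%N w)%R] +
  alpha%:E * \int[P]_w value t alpha (x - D 0%N w)%R.

End inventory.

(* Main.v *)
Require Import Defs.
From HB Require Import structures.
From mathcomp Require Import all_boot all_order all_algebra.
From mathcomp Require Import all_classical all_reals all_analysis.
From mathcomp Require Import measurable_realfun.
From mathcomp Require Import ring lra.

Set Implicit Arguments.
Unset Strict Implicit.
Unset Printing Implicit Defensive.

Import Order.TTheory GRing.Theory Num.Theory.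
Import numFieldNormedType.Exports.

Local Open Scope classical_set_scope.
Local Open Scope ring_scope.

(** The point is that the value function obeys the optimality equation
    v_(t+1)(x) = inf_a (K 1_(a>0) + G_t(x+a)) - c x; once this is known,
    continuity passes from v_t to G_t and from G_t to v_(t+1).

    From v_t to G_t: G_t(y) = c y + E h(y-D) + alpha E v_t(y-D), and
    expectations of continuous functions are continuous by dominated
    convergence ([continuous_mean_after_demand]).  The function h is continuous
    because it is convex, and for y near y0 convexity dominates h(y-D) by
    h(y0-1-D) + h(y0+1-D).  The function v_t is dominated by C (1 + |x|) on
    every half-line x <= m ([dp_growth]): when x is negative one may order up
    to a level in [0, 1], which costs linearly in |x|, and from a level in
    [0, m] one may order nothing.  Since demand is nonnegative and has a finite
    mean, this bound is integrable along y-D.  It is also the reason why all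
    values are finite.

    From G_t to v_(t+1): passing from x to a nearby level can only lose an
    order a whose target x+a falls below the new level; then that target is
    near both levels, and not ordering at all is better up to an arbitrarily
    small error, because the fixed cost is nonnegative
    ([continuous_inf_order]).

    To obtain the optimality equation, define [dp] by the recursion with the
    infimum restricted to a countable set of orders, dense in the admissible
    ones.  Countability makes [dp] measurable, continuous or not, and yields
    measurable, countably valued, nearly optimal decision rules by
    taking the first good order in the enumeration.  For every policy pi the
    expectation of the cost of the first t periods plus alpha^t dp_n(x_t), with
    t + n = N, is nondecreasing in t if [dp] satisfies Bellman's inequality for
    every admissible order ([dp_le_total]), and it increases by at most
    e alpha^t at each step if pi uses the nearly optimal rules
    ([total_le_dp]).  Comparing t = 0 with t = N gives value = dp
    ([inf_total_dp]).  On the integers the countable set is the set of all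
    orders; on the reals Bellman's inequality extends from rational to real
    orders by continuity of G_t, so it is proved in the same induction as the
    continuity of [dp] ([bellman_real], [continuous_dp]).

    Over the integers continuity within the levels is automatic, since they
    form a discrete set. *)

(** * Convex functions and infima over orders *)

Section convexity.
Context (R : realType) (L : set R) (f : R -> R).
Hypothesis f_convex : convex_on L f.
Hypothesis f_ge0 : forall x, L x -> 0 <= f x.

(** [z] is a convex combination of the ends, with weights at most 1. *)
Lemma convex_le_ends a z b : L a -> L z -> L b -> a <= z <= b ->
  f z <= f a + f b.
Proof.
move=> La Lz Lb /andP[az zb].
have fa := f_ge0 La; have fb := f_ge0 Lb.
have [ab|ba] := ltP a b; last first.
  have -> : z = a by apply/eqP; rewrite eq_le az (le_trans zb).
  by rewrite lerDl.
pose l := (b - z) / (b - a).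
have ba0 : 0 < b - a by rewrite subr_gt0.
have l01 : 0 <= l <= 1.
  apply/andP; split; first by rewrite divr_ge0 ?subr_ge0// ltW.
  by rewrite ler_pdivrMr// mul1r lerD2l lerN2.
have zE : l * a + (1 - l) * b = z by rewrite /l; field; rewrite gt_eqF.
have := f_convex La Lb l01; rewrite zE => /(_ Lz) /le_trans; apply.
by move: l01 => /andP[l0 l1]; nra.
Qed.

End convexity.

Section convex_continuous.
Context (R : realType) (f : R -> R).
Hypothesis f_convex : convex_on setT f.
Hypothesis f_ge0 : forall x, 0 <= f x.

(* The lower bound on f (x + l * v) holds because x lies between that point
   and x - v. *)
Let convex_slope x v l : 0 <= l <= 1 ->
  `|f x - f (x + l * v)| <= l * (f (x + v) + f (x - v)).
Proof.
move=> l01; have /andP[l0 l1] := l01.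
have := @f_convex (x + v) x l I I l01 I.
rewrite (_ : l * (x + v) + (1 - l) * x = x + l * v); last by ring.
have m01 : 0 <= (1 + l)^-1 <= 1.
  by rewrite invr_ge0 invf_le1 ?lerDl ?addr_ge0 ?ltr_pwDl.
have := @f_convex (x + l * v) (x - v) _ I I m01 I.
have l10 : 0 < 1 + l by rewrite ltr_pwDl.
rewrite (_ : _ + _ * (x - v) = x); last by field; rewrite gt_eqF.
move=> /(ler_wpM2l (ltW l10)).
rewrite (_ : (1 + l) * (_ + _) = f (x + l * v) + l * f (x - v)); last first.
  by field; rewrite gt_eqF.
have := f_ge0 x; have := f_ge0 (x + v); have := f_ge0 (x - v).
by rewrite ler_norml => *; apply/andP; split; nra.
Qed.

Lemma convex_continuous : continuous f.
Proof.
move=> x; apply/cvgrPdist_le => e e0.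
pose S := f (x + 1) + f (x - 1).
have S0 : 0 <= S by rewrite addr_ge0.
have d0 : 0 < Num.min 1 (e / (1 + S)).
  by rewrite lt_min ltr01 divr_gt0// ltr_pwDl.
near=> y.
have : `|x - y| < Num.min 1 (e / (1 + S)).
  by near: y; exact: cvgr_dist_lt.
rewrite lt_min => /andP[xy1]; rewrite ltr_pdivlMr ?ltr_pwDl// => xyS.
apply: (@le_trans _ _ (`|x - y| * S)); last by have := normr_ge0 (x - y); nra.
have xy01 : 0 <= `|x - y| <= 1 by rewrite normr_ge0 ltW.
have [xy|yx] := leP y x.
  have := convex_slope x (-1) xy01; rewrite [`|x - y|]ger0_norm ?subr_ge0//.
  rewrite (_ : x + (x - y) * -1 = y); last by ring.
  by rewrite opprK [f (x - 1) + _]addrC.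
have := convex_slope x 1 xy01; rewrite [`|x - y|]ltr0_norm ?subr_lt0//.
by rewrite (_ : x + - (x - y) * 1 = y); last by ring.
Unshelve. all: by end_near. Qed.

End convex_continuous.

Section continuous_inf.
Context (R : realType) (K : R) (g W : R -> R).
Hypothesis K_ge0 : 0 <= K.
Hypothesis cg : continuous g.
Hypothesis W_le : forall x a, 0 <= a -> W x <= K * (0 < a)%R%:R + g (x + a).
Hypothesis W_approx : forall x e, 0 < e ->
  exists2 a, 0 <= a & K * (0 < a)%R%:R + g (x + a) < W x + e.

(** [W] plays the role of x |-> inf_(a >= 0) (K 1_(a>0) + g (x + a)).  It is
    upper semicontinuous as an infimum of continuous functions, although the
    cost of an order jumps at a = 0: the order is kept fixed while the level
    moves.  For lower semicontinuity, an order that is good at [y] and reaches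
    a target above [x] can be imitated at [x] with the same fixed cost;
    otherwise its target lies between [y] and [x], where [g] is close to
    [g x]. *)
Lemma continuous_inf_order : continuous W.
Proof.
move=> x; apply/cvgrPdist_le => e e0.
have e2 : 0 < e / 2 by rewrite divr_gt0.
have [a a0 aW] := W_approx x e2.
have /cvgrPdist_lt/(_ _ e2) gxa := @cg (x + a).
have /cvgrPdist_lt/(_ _ e0)[r /= r0 gx] := @cg x.
have cxa : y + a @[y --> x] --> x + a.
  by apply: cvgD; [exact: cvg_id|exact: cvg_cst].
near=> y.
have xyr : `|x - y| < r by near: y; exact: cvgr_dist_lt.
rewrite ler_distlC; apply/andP; split; last first.
  have : `|g (x + a) - g (y + a)| < e / 2 by near: y; exact: cxa gxa.
  rewrite ltr_distlC => /andP[_ gya].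
  by have := W_le y a0; lra.
apply/ler_addgt0Pl => e' e'0.
have [b b0 bW] := W_approx y e'0.
suff : W x <= K * (0 < b)%R%:R + g (y + b) + e by lra.
have near_x z : `|x - z| < r -> W x <= K * (0 < b)%R%:R + g z + e.
  move=> /gx; rewrite ltr_distlC => /andP[gz _].
  have := W_le x (lexx 0); rewrite ltxx mulr0 add0r addr0.
  by have : 0 <= K * (0 < b)%R%:R; [rewrite mulr_ge0|lra].
have [yx|xy] := leP (y + b) x.
  apply: near_x; apply: le_lt_trans xyr.
  by rewrite !ger0_norm ?subr_ge0//; lra.
have [b_eq0|b_neq0] := eqVneq b 0.
  by apply: near_x; rewrite b_eq0 addr0.
have := @W_le x (y + b - x); rewrite subr_ge0 subr_gt0 ltW// xy => /(_ isT).
rewrite (_ : x + (y + b - x) = y + b); last by ring.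
by rewrite lt_neqAle eq_sym b_neq0 b0; lra.
Unshelve. all: by end_near. Qed.

End continuous_inf.

Local Open Scope ereal_scope.

(** * Integration against strategic measures *)

Section integral_mbind.
Context d d' (X : measurableType d) (Y : measurableType d') (R : realType).
Variables (m : {measure set X -> \bar R}) (k : R.-ker X ~> Y).

Import HBNNSimple.

Let sintegral_mbind (f : {nnsfun Y >-> R}) :
  sintegral (mbind m k) f = \int[m]_x sintegral (k x) f.
Proof.
under [RHS]eq_integral do rewrite sintegralE.
rewrite ge0_integral_fsum//; last 2 first.
- by move=> r; apply: measurable_funeM; exact: measurable_kernel.
- by move=> r x _; exact: nnsfun_mulemu_ge0.
rewrite sintegralE; apply: eq_fsbigr => r _.
have [r0|r0] := leP 0%R r.
  by rewrite ge0_integralZl//; exact: measurable_kernel.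
rewrite preimage_nnfun0// measure0 mule0 integral0_eq// => x _.
by rewrite measure0 mule0.
Qed.

(** Both sides agree on simple functions by linearity, and pass to monotone
    limits. *)
Lemma integral_mbind (f : Y -> \bar R) :
  (forall y, 0 <= f y) -> measurable_fun [set: Y] f ->
  \int[mbind m k]_y f y = \int[m]_x \int[k x]_y f y.
Proof.
move=> f0 mf; pose g := nnsfun_approx measurableT mf.
have mg n : measurable_fun [set: Y] (EFin \o g n) by exact/measurable_EFinP.
have g0 n y : 0 <= (EFin \o g n) y by rewrite lee_fin.
have ndg y : {homo (fun n => (g n y)%:E) : a b / (a <= b)%N >-> a <= b}.
  by move=> a b ab; rewrite lee_fin; exact/lefP/nd_nnsfun_approx.
have fE (mu : {measure set Y -> \bar R}) :
    \int[mu]_y f y = limn (fun n => sintegral mu (g n)).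
  transitivity (\int[mu]_y limn (fun n => (g n y)%:E)).
    by apply: eq_integral => y _; apply/esym/cvg_lim => //; exact: cvg_nnsfun_approx.
  rewrite monotone_convergence//; last by move=> n y _; exact: g0.
  by apply: congr_lim; apply/funext => n; rewrite integralT_nnsfun.
rewrite fE (eq_integral (fun x => limn (fun n => sintegral (k x) (g n)))); last first.
  by move=> x _; rewrite fE.
rewrite monotone_convergence//.
- by apply: congr_lim; apply/funext => n; exact: sintegral_mbind.
- move=> n.
  rewrite (_ : (fun x => _) = (fun x => \int[k x]_y (g n y)%:E)); last first.
    by apply/funext => x; rewrite integralT_nnsfun.
  apply: measurable_fun_integral_kernel; [|exact: g0|exact: mg].
  by move=> U mU; exact: measurable_kernel.
- by move=> n x _; exact: sintegral_ge0.
- move=> x _ a b ab; rewrite -!integralT_nnsfun.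
  apply: ge0_le_integral => //; first by move=> y _; exact: g0.
  - exact: mg.
  - exact: mg.
  - by move=> y _; exact: ndg.
Qed.

End integral_mbind.

Section strategic_step.
Context d (T : measurableType d) (R : realType) (P : probability T R).
Variables (s : version) (D : nat -> {RV P >-> R}) (pi : policy R s).
Hypothesis D_iid : iid D.

Lemma integral_demand_law t (f : R -> \bar R) :
  \int[demand_law D t]_u f u = \int[demand_law D 0]_u f u.
Proof.
by apply: eq_measure_integral => B mB _; exact: D_iid.2.
Qed.

(** One period of the dynamics unfolded: draw the order from the decision
    rule, then the demand, whose law is the same in every period. *)
Lemma integral_strategicS x t (f : hist R t.+1 -> \bar R) :
  (forall y, 0 <= f y) -> measurable_fun [set: hist R t.+1] f ->
  \int[strategic D pi x t.+1]_y f y =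
  \int[strategic D pi x t]_y \int[rule pi t y]_a
    \int[demand_law D 0]_u f (y, a, (level y + a - u)%R).
Proof.
move=> f0 mf.
rewrite /= integral_mbind//; apply: eq_integral => y _.
rewrite integral_kcomp//; apply: eq_integral => a _.
rewrite integral_kcomp//= -(integral_demand_law t); apply: eq_integral => u _.
by rewrite integral_dirac// diracT mul1e.
Qed.

End strategic_step.

(** * A countable dense set of orders *)

Section countable_actions.
Context (R : realType).

Definition action (s : version) (n : nat) : R :=
  match s with
  | RealVersion => `|ratr (odflt 0%R (unpickle n : option rat))|%R
  | IntegerVersion => n%:R
  end.

Lemma orders_action s n : orders s (action s n).
Proof. by case: s => /=; [exact: normr_ge0|exists n]. Qed.

Lemma orders_ge0 s (a : R) : orders s a -> (0 <= a)%R.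
Proof. by case: s => //= -[n _ <-]. Qed.

Lemma measurable_orders s : measurable (orders s : set R).
Proof.
case: s => /=.
  by rewrite -(set_itvcy 0%R); exact: measurable_itv.
by apply: countable_measurable => //; exact: card_image_le.
Qed.

Lemma action_nat s (k : nat) : exists n, action s n = k%:R.
Proof.
case: s => /=; last by exists k.
by exists (pickle (k%:R : rat)); rewrite pickleK /= ratr_nat normr_nat.
Qed.

Lemma action_dense (a b : R) : (0 <= a < b)%R ->
  exists n, (a < action RealVersion n < b)%R.
Proof.
move=> /andP[a0 ab]; have [r] := rat_in_itvoo ab.
rewrite in_itv/= => /andP[ar rb]; exists (pickle r) => /=.
by rewrite pickleK/= ger0_norm ?ar// ltW// (le_lt_trans a0).
Qed.

End countable_actions.

(** * Expected total costs *)

Section demand.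
Context d (T : measurableType d) (R : realType) (P : probability T R).
Variable D : nat -> {RV P >-> R}.

Let law : probability R R := demand_law D 0.

Definition mean_after_demand (f : R -> \bar R) (y : R) : \bar R :=
  \int[P]_w f (y - D 0%N w)%R.

(** The period [t] is arbitrary because the expectation defining [G] at time [t]
    involves the demand of that period. *)
Lemma integral_demand t f y : (forall x, 0 <= f x) -> measurable_fun [set: R] f ->
  \int[P]_w f (y - D t w)%R = \int[demand_law D t]_u f (y - u)%R.
Proof.
move=> f0 mf; pose lawt : probability R R := demand_law D t.
transitivity (\int[lawt]_u f (y - u)%R) => //.
rewrite (ge0_integral_distribution (D t) (f := fun u => f (y - u)%R))//.
by apply: measurableT_comp => //; exact: measurable_funB.
Qed.

Lemma mean_after_demandE f y : (forall x, 0 <= f x) -> measurable_fun [set: R] f ->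
  mean_after_demand f y = \int[law]_u f (y - u)%R.
Proof. exact: integral_demand. Qed.

Lemma integral_lawD A B f y : 0 <= A -> 0 <= B ->
    (forall x, 0 <= f x) -> measurable_fun [set: R] f ->
  \int[demand_law D 0]_u (A + B * f (y - u)%R) = A + B * mean_after_demand f y.
Proof.
move=> A0 B0 f0 mf.
have m1 : measurable_fun [set: R] (fun u => f (y - u)%R).
  by apply: measurableT_comp => //; exact: measurable_funB.
transitivity (\int[law]_u (cst A u + B * f (y - u)%R)) => //.
rewrite (ge0_integralD law)//; last 2 first.
- by move=> u _; exact: mule_ge0.
- exact: measurable_funeM.
rewrite (ge0_integralZl law)// mean_after_demandE//; congr (_ + _).
rewrite -[RHS]mule1 -(@probability_setT _ _ _ law).
exact: (integral_cst law).
Qed.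

Lemma mean_after_demand_ge0 f : (forall x, 0 <= f x) ->
  forall y, 0 <= mean_after_demand f y.
Proof. by move=> f0 y; exact: integral_ge0. Qed.

Lemma measurable_mean_after_demand f : (forall x, 0 <= f x) ->
  measurable_fun [set: R] f -> measurable_fun [set: R] (mean_after_demand f).
Proof.
move=> f0 mf.
rewrite (_ : mean_after_demand f =
    fubini_F law (fun z : R * R => f (z.1 - z.2)%R)); last first.
  by apply/funext => y; rewrite mean_after_demandE.
apply: measurable_fun_fubini_tonelli_F => //.
by apply: measurableT_comp => //; exact: measurable_funB.
Qed.

End demand.

Section total_costs.
Context d (T : measurableType d) (R : realType) (P : probability T R).
Variables (s : version) (D : nat -> {RV P >-> R}) (alpha : R).
Variable g : R -> R -> \bar R.
Hypothesis alpha_ge0 : (0 <= alpha)%R.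
Hypothesis D_iid : iid D.
Hypothesis mg : measurable_fun [set: R * R] (fun z => g z.1 z.2).

(** The right-hand side of the optimality equation before minimization over
    the order [a]; [f] is the cost to go. *)
Definition action_cost (f : R -> \bar R) (x a : R) : \bar R :=
  g x a + alpha%:E * mean_after_demand D f (x + a)%R.

Fixpoint total (N : nat) : hist R N -> \bar R :=
  match N return hist R N -> \bar R with
  | 0 => fun=> 0
  | t.+1 => fun y => total y.1.1 + (alpha ^+ t)%:E * g (level y.1.1) y.1.2
  end.

Let mcost d' (X : measurableType d') (u v : X -> R) :
  measurable_fun [set: X] u -> measurable_fun [set: X] v ->
  measurable_fun [set: X] (fun y => g (u y) (v y)).
Proof. by move=> mu mv; exact: (measurableT_comp mg (measurable_fun_pair mu mv)). Qed.

Lemma measurable_total N : measurable_fun [set: hist R N] (@total N).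
Proof.
elim: N => [|N IH] /=; first exact: measurable_cst.
have m1 : measurable_fun [set: hist R N * R * R] (fun y => y.1.1).
  exact: measurableT_comp.
apply: emeasurable_funD; first exact: measurableT_comp IH m1.
apply: measurable_funeM; apply: mcost; last exact: measurableT_comp.
exact: measurableT_comp (@measurable_level R N) m1.
Qed.

Lemma measurable_action_cost d' (X : measurableType d') (u v : X -> R) f :
  (forall x, 0 <= f x) -> measurable_fun [set: R] f ->
  measurable_fun [set: X] u -> measurable_fun [set: X] v ->
  measurable_fun [set: X] (fun y => action_cost f (u y) (v y)).
Proof.
move=> f0 mf mu mv; apply: emeasurable_funD; first exact: mcost.
apply: measurable_funeM; apply: measurableT_comp; last exact: measurable_funD.
exact: measurable_mean_after_demand.
Qed.

Hypothesis g_ge0 : forall x a, 0 <= g x a.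

Lemma action_cost_ge0 f : (forall x, 0 <= f x) -> forall x a, 0 <= action_cost f x a.
Proof.
move=> f0 x a; apply: adde_ge0 => //.
by apply: mule_ge0; [rewrite lee_fin|exact: mean_after_demand_ge0].
Qed.

Lemma total_ge0 N (y : hist R N) : 0 <= total y.
Proof.
elim: N y => [//|N IH] y /=; apply: adde_ge0 => //.
by apply: mule_ge0; [rewrite lee_fin exprn_ge0|].
Qed.

(** Integrating out the last period turns the cost to go [f] after it into the
    expected [action_cost] before it.  It serves the comparisons of policies
    with [dp] as well as the count of negative orders. *)
Lemma integral_total_step (pi : policy R s) x t f :
  (forall x, 0 <= f x) -> measurable_fun [set: R] f ->
  \int[strategic D pi x t.+1]_y (total y + (alpha ^+ t.+1)%:E * f (level y)) =
  \int[strategic D pi x t]_y (total y +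
     (alpha ^+ t)%:E * \int[rule pi t y]_a action_cost f (level y) a).
Proof.
move=> f0 mf.
have aX n : 0 <= (alpha ^+ n)%:E by rewrite lee_fin exprn_ge0.
rewrite integral_strategicS//; last 2 first.
- move=> y; apply: adde_ge0; first exact: total_ge0.
  exact: mule_ge0.
- apply: emeasurable_funD; first exact: measurable_total.
  apply: measurable_funeM; apply: measurableT_comp => //.
  exact: measurable_level.
apply: eq_integral => y _ /=.
rewrite -ge0_integralZl//; last 2 first.
- by apply: measurable_action_cost.
- by move=> a _; exact: action_cost_ge0.
rewrite -[X in X + _](_ : \int[rule pi t y]_a total y = total y); last first.
  by rewrite integral_cst// prob_kernel mule1.
rewrite -ge0_integralD//; last 3 first.
- by move=> a _; exact: total_ge0.
- by move=> a _; apply: mule_ge0 => //; exact: action_cost_ge0.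
- by apply: measurable_funeM; apply: measurable_action_cost.
apply: eq_integral => a _.
rewrite integral_lawD//; last first.
  apply: adde_ge0; first exact: total_ge0.
  exact: mule_ge0.
rewrite -addeA; congr (_ + _).
rewrite exprSr EFinM -muleA -ge0_muleDr//.
by apply: mule_ge0; [rewrite lee_fin|exact: mean_after_demand_ge0].
Qed.

End total_costs.

(** * Nonnegative form of the one-step cost *)

Lemma measure0_setC d (X : measurableType d) (R : realType)
    (m : {measure set X -> \bar R}) (A : set X) :
  m A = 1 -> m setT = 1 -> measurable A -> m (~` A) = 0.
Proof.
move=> mA1 mT1 mA.
have mAC : m (A `|` ~` A) = m A + m (~` A).
  by apply: measureU => //; [exact: measurableC|exact: setICr].
move: mAC; rewrite setUv mA1 mT1; case: (m (~` A)) => [r| |]//.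
by move=> -[] /eqP; rewrite -[X in X == _]addr0 (inj_eq (addrI _)) => /eqP <-.
Qed.

Section costs.
Context d (T : measurableType d) (R : realType) (P : probability T R).
Variables (s : version) (K c : R) (h : R -> R) (D : nat -> {RV P >-> R}).
Variable alpha : R.
Hypothesis alpha_ge0 : (0 <= alpha)%R.
Hypothesis D_iid : iid D.
Hypothesis h_ge0 : forall x, (0 <= h x)%R.
Hypothesis mh : measurable_fun [set: R] h.

Definition order_cost (a : R) : R := (K * (0 < a)%R%:R + c * a)%R.

Lemma measurable_order_cost : measurable_fun [set: R] order_cost.
Proof.
apply: measurable_funD; last exact: measurable_funM.
apply: measurable_funM => //.
rewrite (_ : (fun a => _) = \1_(`]0%R, +oo[ : set R)).
  by apply: measurable_indic; exact: measurable_itv.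
by apply/funext => a; rewrite indicE mem_setE in_itv/= andbT.
Qed.

Let mean_h_ge0 y : 0 <= mean_after_demand D (EFin \o h) y.
Proof. by apply: mean_after_demand_ge0 => z; rewrite lee_fin. Qed.

Let mmean_h : measurable_fun [set: R] (mean_after_demand D (EFin \o h)).
Proof.
apply: measurable_mean_after_demand; first by move=> y; rewrite lee_fin.
exact/measurable_EFinP.
Qed.

Lemma one_step_costE x a : one_step_cost K c h D x a =
  (order_cost a)%:E + mean_after_demand D (EFin \o h) (x + a)%R.
Proof. by rewrite /one_step_cost unlock. Qed.

Lemma measurable_one_step_cost :
  measurable_fun [set: R * R] (fun z => one_step_cost K c h D z.1 z.2).
Proof.
under eq_fun do rewrite one_step_costE.
apply: emeasurable_funD.
  apply/measurable_EFinP; apply: measurableT_comp => //.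
  exact: measurable_order_cost.
by apply: measurableT_comp => //; exact: measurable_funD.
Qed.

(** The one-step cost may be negative for negative orders, which decision
    rules avoid only almost surely.  Taking the absolute value of the ordering cost
    makes integrals of nonnegative functions available everywhere. *)
Definition abs_cost (x a : R) : \bar R :=
  `|order_cost a|%:E + mean_after_demand D (EFin \o h) (x + a)%R.

Lemma abs_cost_ge0 x a : 0 <= abs_cost x a.
Proof. by apply: adde_ge0; first by rewrite lee_fin. Qed.

Lemma measurable_abs_cost :
  measurable_fun [set: R * R] (fun z => abs_cost z.1 z.2).
Proof.
apply: emeasurable_funD.
  apply/measurable_EFinP; apply: measurableT_comp => //.
  by apply: measurableT_comp => //; exact: measurable_order_cost.
by apply: measurableT_comp => //; exact: measurable_funD.
Qed.

Lemma one_step_cost_abs x a : (0 <= K)%R -> (0 <= c)%R -> (0 <= a)%R ->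
  one_step_cost K c h D x a = abs_cost x a.
Proof.
move=> K0 c0 a0; rewrite one_step_costE /abs_cost ger0_norm//.
by rewrite addr_ge0// mulr_ge0.
Qed.

Lemma rule_orders_neg (pi : policy R s) t y :
  rule pi t y [set a | (a < 0)%R] = 0.
Proof.
have mn : measurable [set a : R | (a < 0)%R].
  by rewrite -(set_itvNyo 0%R); exact: measurable_itv.
apply/eqP; rewrite -measure_le0.
have mo := @measurable_orders R s.
apply: (@le_trans _ _ (rule pi t y (~` orders s))).
  apply: le_measure; rewrite ?inE//; first exact: measurableC.
  by move=> a /= a0 /orders_ge0; rewrite leNgt a0.
rewrite (measure0_setC (rule_orders pi y))//; exact: prob_kernel.
Qed.

(* The [total] of this one-step cost with discount 1 is the number of negative
   orders in a history. *)
Let neg (x a : R) : \bar R := (\1_[set a : R | (a < 0)%R] a)%:E.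

Let mneg : measurable_fun [set: R * R] (fun z => neg z.1 z.2).
Proof.
apply/measurable_EFinP/measurableT_comp => //; apply: measurable_indic.
by rewrite -(set_itvNyo 0%R); exact: measurable_itv.
Qed.

Let neg0 x a : 0 <= neg x a. Proof. by rewrite lee_fin. Qed.

(** Each decision rule gives mass 0 to negative orders, so by induction their
    expected number is 0. *)
Lemma integral_total_neg (pi : policy R s) x N :
  \int[strategic D pi x N]_y total 1 neg y = 0.
Proof.
elim: N => [|N IH]; first by rewrite integral0.
have := @integral_total_step _ _ _ _ s D 1%R neg ler01 D_iid mneg neg0 pi x N
  (fun=> 0) (fun=> lexx _) (measurable_cst _).
under eq_integral do rewrite mule0 adde0.
move=> ->; rewrite -[RHS]IH; apply: eq_integral => y _.
rewrite (eq_integral (fun a => (\1_[set a : R | (a < 0)%R] a)%:E)); last first.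
  by move=> a _; rewrite /action_cost /mean_after_demand integral0 mule0 adde0.
rewrite integral_indic//; last first.
  by rewrite -(set_itvNyo 0%R); exact: measurable_itv.
by rewrite setIT rule_orders_neg mule0 adde0.
Qed.

Lemma total_neg0 N (y : hist R N) : (0 <= K)%R -> (0 <= c)%R ->
  total 1 neg y = 0 -> total alpha (one_step_cost K c h D) y = total alpha abs_cost y.
Proof.
move=> K0 c0; elim: N y => [//|N IH] y /=; rewrite expr1n mul1e.
move=> /eqP; rewrite padde_eq0//; last exact: total_ge0.
move=> /andP[/eqP /IH -> /eqP]; rewrite /neg indicE.
have [a0|a0 _] := ltP y.1.2 0%R; last by rewrite one_step_cost_abs.
by rewrite mem_set// => -[] /eqP; rewrite oner_eq0.
Qed.

(** Almost surely a history contains no negative order, and then the two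
    one-step costs agree along it. *)
Lemma policy_valueE (pi : policy R s) N x : (0 <= K)%R -> (0 <= c)%R ->
  policy_value K c h D pi N alpha x =
  \int[strategic D pi x N]_y total alpha abs_cost y.
Proof.
move=> K0 c0; rewrite /policy_value.
have -> : @total_cost _ _ _ _ K c h D alpha N = total alpha (one_step_cost K c h D) (N := N).
  by apply/funext; elim: N => [//|N IH] y /=; rewrite IH.
have /ae_eq_integral_abs : \int[strategic D pi x N]_y `|total 1 neg y| = 0.
  rewrite -[RHS](integral_total_neg pi x N); apply: eq_integral => y _.
  by rewrite gee0_abs// total_ge0.
move=> /(_ measurableT (measurable_total _ mneg (N:=N))) negE.
apply: ae_eq_integral => //.
- apply: measurable_total; exact: measurable_one_step_cost.
- apply: measurable_total; exact: measurable_abs_cost.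
- by apply: filterS negE => y /(_ I) y0 _; exact: total_neg0.
Qed.

End costs.

(** * Dynamic programming computes the optimal value *)

Section verification.
Context d (T : measurableType d) (R : realType) (P : probability T R).
Variables (s : version) (D : nat -> {RV P >-> R}) (alpha : R).
Variable g : R -> R -> \bar R.
Hypothesis alpha_ge0 : (0 <= alpha)%R.
Hypothesis D_iid : iid D.
Hypothesis mg : measurable_fun [set: R * R] (fun z => g z.1 z.2).
Hypothesis g_ge0 : forall x a, 0 <= g x a.

(** The infimum runs over a countable set of orders so that [dp] is measurable
    as a countable infimum of measurable functions. *)
Fixpoint dp (n : nat) (x : R) : \bar R :=
  if n is m.+1 then
    ereal_inf (range (fun k => action_cost D alpha g (dp m) x (action R s k)))
  else 0.

Lemma dp_ge0 n x : 0 <= dp n x.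
Proof.
elim: n x => [//|n IH] x /=; apply/ereal_infP => _ [k _ <-].
exact: action_cost_ge0.
Qed.

Lemma measurable_dp n : measurable_fun [set: R] (dp n).
Proof.
elim: n => [|n IH]; first exact: measurable_cst.
rewrite (_ : dp n.+1 = (fun x =>
    einfs (fun k => action_cost D alpha g (dp n) x (action R s k)) 0%N)).
  apply: (measurable_fun_einfs
    (f := fun k x => action_cost D alpha g (dp n) x (action R s k))) => k.
  by apply: measurable_action_cost => //; exact: dp_ge0.
apply/funext => x /=; rewrite /einfs/=; congr ereal_inf.
by apply/seteqP; split => _ [k _ <-]; exists k.
Qed.

Let aX t : 0 <= (alpha ^+ t)%:E.
Proof. by rewrite lee_fin exprn_ge0. Qed.

Let mlevel f t : measurable_fun [set: R] f ->
  measurable_fun [set: hist R t] (fun y => (alpha ^+ t)%:E * f (level y)).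
Proof.
move=> mf; apply: measurable_funeM; apply: measurableT_comp => //.
exact: measurable_level.
Qed.

Let maction (pi : policy R s) f t : (forall x, 0 <= f x) -> measurable_fun [set: R] f ->
  measurable_fun [set: hist R t]
    (fun y => \int[rule pi t y]_a action_cost D alpha g f (level y) a).
Proof.
move=> f0 mf.
apply: (measurable_fun_integral_sfinite_kernel
  (fun z => action_cost D alpha g f (level z.1) z.2)).
  by move=> z; exact: action_cost_ge0.
apply: measurable_action_cost => //.
by apply: measurableT_comp => //; exact: measurable_level.
Qed.

(** Bellman's inequality makes the expectation of the cost of [t] periods plus
    the discounted [dp] of the remaining ones nondecreasing in [t]. *)
Lemma dp_le_total (pi : policy R s) x N :
  (forall n x a, orders s a -> dp n.+1 x <= action_cost D alpha g (dp n) x a) ->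
  dp N x <= \int[strategic D pi x N]_y total alpha g y.
Proof.
move=> bellman.
suff tn t n : dp (t + n) x <=
    \int[strategic D pi x t]_y (total alpha g y + (alpha ^+ t)%:E * dp n (level y)).
  have := tn N 0%N; rewrite addn0 => /le_trans; apply.
  by under eq_integral do rewrite mule0 adde0.
elim: t n => [|t IH] n.
  rewrite integral_dirac// ?diracT ?mul1e ?add0e ?expr0 ?mul1e//.
  apply: emeasurable_funD; first exact: measurable_total.
  exact: mlevel (measurable_dp n).
rewrite addSnnS; apply: le_trans (IH n.+1) _.
rewrite integral_total_step//; [|exact: dp_ge0|exact: measurable_dp].
apply: ge0_le_integral => //.
- by move=> y _; apply: adde_ge0; [exact: total_ge0|apply: mule_ge0 => //; exact: dp_ge0].
- by apply: emeasurable_funD; [exact: measurable_total|exact: mlevel (measurable_dp _)].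
- apply: emeasurable_funD; first exact: measurable_total.
  by apply: measurable_funeM; apply: maction; [exact: dp_ge0|exact: measurable_dp].
move=> y _; apply: leeD2l; apply: lee_wpmul2l => //.
have mQ : measurable_fun [set: R] (action_cost D alpha g (dp n) (level y)).
  by apply: measurable_action_cost => //; [exact: dp_ge0|exact: measurable_dp].
have Q0 a : 0 <= action_cost D alpha g (dp n) (level y) a.
  by apply: action_cost_ge0 => //; exact: dp_ge0.
have mo := @measurable_orders R s.
apply: (@le_trans _ _ (\int[rule pi t y]_(a in orders s)
    action_cost D alpha g (dp n) (level y) a)); last first.
  exact: ge0_subset_integral.
apply: (@le_trans _ _ (\int[rule pi t y]_(a in orders s) dp n.+1 (level y))).
  by rewrite integral_cst// rule_orders mule1.
apply: ge0_le_integral => //.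
- by move=> a _; exact: dp_ge0.
- exact: measurable_funTS.
- by move=> a oa; exact: bellman.
Qed.

Section selector.
Variables (e : R) (n : nat).
Hypothesis e0 : (0 < e)%R.

Definition near_optimal (x : R) (k : nat) : bool :=
  action_cost D alpha g (dp n) x (action R s k) <= dp n.+1 x + e%:E.

Lemma near_optimal_ex x : exists k, near_optimal x k.
Proof.
have [finx|] := boolP (dp n.+1 x \is a fin_num).
  have [_ [k _ <-] /ltW kP] := lb_ereal_inf_adherent e0 finx.
  by exists k.
rewrite ge0_fin_numE ?dp_ge0// -leNgt leye_eq => /eqP oo.
by exists 0%N; rewrite /near_optimal oo /= addye ?leey.
Qed.

Definition selector (x : R) : R := action R s (ex_minn (near_optimal_ex x)).

Lemma selectorP x :
  action_cost D alpha g (dp n) x (selector x) <= dp n.+1 x + e%:E.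
Proof. by rewrite /selector; case: ex_minnP. Qed.

(** The selector is the first nearly optimal order of the enumeration, so its
    level sets are Boolean combinations of the measurable sets where a given
    order is nearly optimal. *)
Lemma measurable_selector : measurable_fun [set: R] selector.
Proof.
have mno k : measurable [set x | near_optimal x k].
  rewrite -[X in measurable X]setTI; apply: measurable_lee => //.
    by apply: measurable_action_cost => //; [exact: dp_ge0|exact: measurable_dp].
  by apply: emeasurable_funD => //; exact: measurable_dp.
have mB k : measurable [set x | ex_minn (near_optimal_ex x) = k].
  rewrite (_ : mkset _ = [set x | near_optimal x k] `&`
      \bigcap_(j in [set j | (j < k)%N]) ~` [set x | near_optimal x j]).
    apply: measurableI => //; apply: bigcap_measurableType => j _.
    exact: measurableC.
  apply/seteqP; split => x /=.
    case: ex_minnP => m mP mmin <-; split=> // j /= jm /mmin.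
    by rewrite leqNgt jm.
  case: ex_minnP => m mP mmin [kP kmin]; apply/eqP.
  rewrite eqn_leq mmin//= leqNgt; apply/negP => mk.
  exact: kmin mk mP.
move=> _ B mBB; rewrite setTI.
rewrite (_ : _ @^-1` B = \bigcup_(k in [set k | B (action R s k)])
    [set x | ex_minn (near_optimal_ex x) = k]).
  by apply: bigcup_measurable => k _; exact: mB.
apply/seteqP; split => x /=; first by move=> Bx; exists (ex_minn (near_optimal_ex x)).
by move=> [k Bk /= kE]; rewrite /selector kE.
Qed.

End selector.

Lemma strategic_setT (pi : policy R s) x t : strategic D pi x t setT = 1.
Proof.
have -> : strategic D pi x t setT = \int[strategic D pi x t]_y 1.
  by rewrite integral_cst// mul1e.
elim: t => [|t IH].
  by rewrite integral_dirac// diracT mul1e.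
rewrite integral_strategicS// -[RHS]IH; apply: eq_integral => y _.
rewrite (eq_integral (fun=> 1)).
  by rewrite integral_cst// mul1e prob_kernel.
move=> a _; rewrite integral_cst// mul1e.
exact: (@probability_setT _ _ _ (demand_law D 0)).
Qed.

(** The policy follows, at time [t], the [e]-optimal selector for the
    [N - t.+1] periods that remain after the decision. *)
Lemma total_le_dp N (e : R) : (0 < e)%R -> exists pi : policy R s,
  forall x, \int[strategic D pi x N]_y total alpha g y <=
    dp N x + (e * \sum_(i < N) alpha ^+ i)%R%:E.
Proof.
move=> e0.
have msel t : measurable_fun [set: hist R t]
    (fun y => selector (N - t.+1) e0 (level y)).
  by apply: measurableT_comp; [exact: measurable_selector|exact: measurable_level].
have kord t y : kdirac (R := R) (msel t) y (orders s) = 1.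
  rewrite /kdirac /= diracE mem_set//; exact: orders_action.
pose pi := Policy (rule := fun t => kdirac (R := R) (msel t)) kord.
exists pi => x.
suff tn t n : (t + n = N)%N ->
    \int[strategic D pi x t]_y (total alpha g y + (alpha ^+ t)%:E * dp n (level y)) <=
    dp N x + (e * \sum_(i < t) alpha ^+ i)%R%:E.
  have := tn N 0%N (addn0 N); apply: le_trans.
  by under [leRHS]eq_integral do rewrite mule0 adde0.
elim: t n => [|t IH] n tnN.
  rewrite big_ord0 mulr0 adde0 integral_dirac//.
    by rewrite diracT mul1e add0e expr0 mul1e -tnN.
  apply: emeasurable_funD; first exact: measurable_total.
  exact: mlevel (measurable_dp n).
rewrite integral_total_step//; [|exact: dp_ge0|exact: measurable_dp].
have mt1 : measurable_fun [set: hist R t]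
    (fun y => total alpha g y + (alpha ^+ t)%:E * dp n.+1 (level y)).
  by apply: emeasurable_funD; [exact: measurable_total|exact: mlevel (measurable_dp _)].
have t10 y : 0 <= total alpha g y + (alpha ^+ t)%:E * dp n.+1 (level y).
  by apply: adde_ge0; [exact: total_ge0|apply: mule_ge0 => //; exact: dp_ge0].
apply: (@le_trans _ _ (\int[strategic D pi x t]_y
    ((total alpha g y + (alpha ^+ t)%:E * dp n.+1 (level y)) + (alpha ^+ t * e)%:E))).
  apply: ge0_le_integral => //.
  - move=> y _; apply: adde_ge0; first exact: total_ge0.
    by apply: mule_ge0 => //; apply: integral_ge0 => a _; apply: action_cost_ge0 => //; exact: dp_ge0.
  - apply: emeasurable_funD; first exact: measurable_total.
    by apply: measurable_funeM; apply: maction; [exact: dp_ge0|exact: measurable_dp].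
  - exact: emeasurable_funD.
  move=> y _; rewrite -addeA; apply: leeD2l.
  rewrite EFinM -ge0_muleDr ?lee_fin//; [|exact: dp_ge0|exact: ltW].
  apply: lee_wpmul2l => //=.
  rewrite integral_dirac//; last first.
    by apply: measurable_action_cost => //; [exact: dp_ge0|exact: measurable_dp].
  rewrite diracT mul1e.
  have -> : (N - t.+1 = n)%N by rewrite -tnN addKn.
  exact: selectorP.
rewrite ge0_integralD//; last first.
  by move=> y _; rewrite lee_fin mulr_ge0 ?exprn_ge0// ltW.
rewrite integral_cst// strategic_setT mule1 big_ord_recr/= mulrDr EFinD addeA.
rewrite [(alpha ^+ t * e)%R]mulrC; apply: leeD => //.
by apply: (IH n.+1); rewrite addnS -addSn.
Qed.

Lemma inf_total_dp N x :
  (forall n x a, orders s a -> dp n.+1 x <= action_cost D alpha g (dp n) x a) ->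
  ereal_inf [set \int[strategic D pi x N]_y total alpha g y | pi in [set: policy R s]] =
  dp N x.
Proof.
move=> bellman; apply/eqP; rewrite eq_le; apply/andP; split; last first.
  by apply/ereal_infP => _ [pi _ <-]; exact: dp_le_total.
apply/lee_addgt0Pr => e e0.
pose S := (\sum_(i < N) alpha ^+ i)%R.
have S0 : (0 <= S)%R by apply: sumr_ge0 => i _; exact: exprn_ge0.
have e1 : (0 < e / (1 + S))%R by rewrite divr_gt0// ltr_pwDl.
have [pi piP] := total_le_dp N e1.
apply: (@le_trans _ _ (\int[strategic D pi x N]_y total alpha g y)).
  by apply: ereal_inf_lbound; exists pi.
apply: le_trans (piP x) _; apply: leeD2l; rewrite lee_fin -/S.
by rewrite mulrAC ler_pdivrMr ?ltr_pwDl// ler_pM2l// lerDr.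
Qed.

End verification.

(** * Levels of the two versions *)

Section levels.
Context (R : realType) (s : version).

Lemma levels_nat k : levels s (k%:R : R).
Proof. by case: s => //=; exists (k%:Z)%R => //; rewrite -pmulrn. Qed.

Lemma levelsD (x y : R) : levels s x -> levels s y -> levels s (x + y)%R.
Proof.
by case: s => //= -[i _ <-] [j _ <-]; exists (i + j)%R => //; rewrite intrD.
Qed.

Lemma levelsB (x y : R) : levels s x -> levels s y -> levels s (x - y)%R.
Proof.
by case: s => //= -[i _ <-] [j _ <-]; exists (i - j)%R => //; rewrite intrB.
Qed.

(** A function that vanishes off a countable set is measurable. *)
Lemma measurable_off_levels (h : R -> R) : s = IntegerVersion ->
  (forall x, ~ levels s x -> h x = 0%R) -> measurable_fun [set: R] h.
Proof.
move=> -> /= h_off.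
have cR : countable (range (intr : int -> R)).
  exact: sub_countable (card_image_le _ _) (countableP _).
have cZ (A : set R) : measurable (range (intr : int -> R) `&` A).
  apply: countable_measurable => //.
  by apply: sub_countable cR; apply: subset_card_le; exact: subIsetl.
rewrite -(setUv (range (intr : int -> R))); apply/measurable_funU.
- by rewrite -[range _]setIT; exact: cZ.
- by apply: measurableC; rewrite -[range _]setIT; exact: cZ.
split; first by move=> _ B mB; exact: cZ.
apply: (@eq_measurable_fun _ _ _ _ _ (cst (0%R : R))); last exact: measurable_cst.
by move=> x; rewrite inE => /h_off.
Qed.

(** Distinct integers are at distance at least 1. *)
Lemma continuous_integer_levels (f : R -> R) : s = IntegerVersion ->
  {within levels s, continuous f}.
Proof.
move=> -> /=; apply/subspace_continuousP => _ [i _ <-].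
apply: cvg_near_cst; rewrite near_withinE; near=> y => -[j _ jy].
have : (`|i%:~R - y| < 1 :> R)%R by near: y; exact: cvgr_dist_lt.
rewrite -jy -intrB -intr_norm ltrz1 -[1%R]add0r ltzD1 normr_le0 subr_eq0.
by move=> /eqP ->.
Unshelve. all: by end_near. Qed.

End levels.

(** * Growth and continuity of the value *)

Section model.
Context d (T : measurableType d) (R : realType) (P : probability T R).
Variables (s : version) (K c : R) (h : R -> R) (D : nat -> {RV P >-> R}).
Variable alpha : R.
Hypothesis K_ge0 : (0 <= K)%R.
Hypothesis c_ge0 : (0 <= c)%R.
Hypothesis h_ge0 : forall x, (0 <= h x)%R.
Hypothesis mh : measurable_fun [set: R] h.
Hypothesis h_convex : convex_on (levels s) h.
Hypothesis D_iid : iid D.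
Hypothesis D_ge0 : forall t w, (0 <= D t w)%R.
Hypothesis D_levels : forall t w, levels s (D t w).
Hypothesis D_mean : 'E_P[D 0%N] < +oo.
Hypothesis h_mean : forall x, levels s x ->
  mean_after_demand D (EFin \o h) x < +oo.
Hypothesis alpha_ge0 : (0 <= alpha)%R.

Let hbar := mean_after_demand D (EFin \o h).
Let V := dp s D alpha (abs_cost K c h D).
Let ED := fine 'E_P[D 0%N].

Let V_ge0 n x : 0 <= V n x.
Proof. by apply: dp_ge0 => // y a; exact: abs_cost_ge0. Qed.

Let mV n : measurable_fun [set: R] (V n).
Proof.
apply: measurable_dp => //; [exact: measurable_abs_cost|].
by move=> y a; exact: abs_cost_ge0.
Qed.

Let hbar_ge0 x : 0 <= hbar x.
Proof. by apply: mean_after_demand_ge0 => y; rewrite lee_fin. Qed.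

Let hbarE x : levels s x -> hbar x = (fine (hbar x))%:E.
Proof. by move=> /h_mean hx; rewrite fineK// ge0_fin_numE. Qed.

Let EDE : \int[P]_w (D 0%N w)%:E = ED%:E.
Proof.
rewrite -expectation_def fineK// ge0_fin_numE//.
exact: expectation_ge0.
Qed.

Lemma measurable_after_demand (f : R -> R) y : measurable_fun [set: R] f ->
  measurable_fun [set: T] (fun w => f (y - D 0%N w)%R).
Proof. by move=> mf; apply: measurableT_comp => //; exact: measurable_funB. Qed.

Let mhw y : measurable_fun [set: T] (fun w => (h (y - D 0%N w)%R)%:E).
Proof. by apply/measurable_EFinP; exact: measurable_after_demand. Qed.

Lemma hbar_le_ends a z b : levels s a -> levels s z -> levels s b ->
  (a <= z <= b)%R -> hbar z <= hbar a + hbar b.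
Proof.
move=> La Lz Lb /andP[az zb].
have h0 y w : 0 <= (EFin \o h) (y - D 0%N w)%R by rewrite lee_fin.
have mhD y : measurable_fun [set: T] (fun w => (EFin \o h) (y - D 0%N w)%R).
  exact: mhw.
rewrite /hbar /mean_after_demand -ge0_integralD//.
apply: ge0_le_integral => //; first exact: emeasurable_funD.
move=> w _ /=; rewrite -EFinD lee_fin.
apply: (convex_le_ends h_convex) => //; [exact: levelsB..|].
by rewrite !lerD2r az.
Qed.

Lemma mean_affine (A B : R) : (0 <= A)%R -> (0 <= B)%R ->
  \int[P]_w (A + B * D 0%N w)%:E = (A + B * ED)%:E.
Proof.
move=> A0 B0; under eq_integral do rewrite EFinD EFinM.
have mD : measurable_fun [set: T] (fun w => (D 0%N w)%:E).
  exact/measurable_EFinP.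
rewrite ge0_integralD//; last 2 first.
- by move=> w _; rewrite mule_ge0// lee_fin.
- exact: measurable_funeM.
rewrite ge0_integralZl//; last by move=> w _; rewrite lee_fin.
rewrite EDE EFinD EFinM; congr (_ + _).
by rewrite -[RHS]mule1 -(probability_setT P); exact: integral_cst.
Qed.

Lemma mean_after_demand_le n C m y : (0 <= C)%R -> levels s y -> (y <= m)%R ->
  (forall x, levels s x -> (x <= m)%R -> V n x <= (C * (1 + `|x|))%:E) ->
  mean_after_demand D (V n) y <= (C * (1 + `|y|) + C * ED)%:E.
Proof.
move=> C0 Ly ym VC.
rewrite -mean_affine ?mulr_ge0 ?addr_ge0//.
apply: ge0_le_integral => //.
- apply: measurableT_comp => //; exact: measurable_funB.
- apply/measurable_EFinP; apply: measurable_funD => //.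
  exact: measurable_funM.
move=> w _; have Lyw := levelsB Ly (D_levels 0%N w).
apply: le_trans (VC _ Lyw _) _; first by have := D_ge0 0%N w; lra.
rewrite lee_fin -mulrDr ler_wpM2l// -addrA lerD2l.
by apply: le_trans (ler_normB _ _) _; rewrite [`|D _ _|%R]ger0_norm.
Qed.

(** At a negative level, an integer order reaches ]0, 1]; integer orders belong
    to the countable set of orders in both versions. *)
Lemma order_up (x : R) m : (x <= m.+1%:R)%R -> exists k : nat,
  [/\ (0 <= x + k%:R <= m.+1%:R)%R & (k%:R <= `|x| + 1)%R].
Proof.
move=> xm; have [x0|x0] := leP 0%R x.
  by exists 0%N; rewrite addr0 x0 addr_ge0.
have /andP[k0 k1] : ((Num.truncn (- x))%:R <= - x < (Num.truncn (- x)).+1%:R)%R.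
  by apply: truncn_itv; lra.
exists (Num.truncn (- x)).+1; move: k0 k1; rewrite ltr0_norm// -!natr1.
by have := ler0n R m => *; split; [apply/andP; split|]; lra.
Qed.

(** Compare with the order of [order_up], which leads to a level in
    [0, m.+1].  There the expected holding cost is bounded by its values at the
    ends, and the cost to go is controlled by the induction hypothesis for the
    half-line x <= m.+1, which demand cannot leave. *)
Lemma dp_growth n m : exists2 C : R, (0 <= C)%R &
  forall x, levels s x -> (x <= m%:R)%R -> V n x <= (C * (1 + `|x|))%:E.
Proof.
elim: n m => [|n IH] m.
  by exists 0%R => // x _ _; rewrite mul0r.
have [C C0 VC] := IH m.+1.
pose hb := (fine (hbar 0%R) + fine (hbar m.+1%:R))%R.
have hb0 : (0 <= hb)%R by rewrite addr_ge0 ?fine_ge0.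
have ED0 : (0 <= ED)%R by apply: fine_ge0; exact: expectation_ge0.
pose B := (alpha * (C * (1 + m.+1%:R) + C * ED))%R.
have B0 : (0 <= B)%R by rewrite !(mulr_ge0, addr_ge0).
exists (K + c + hb + B)%R; first by do 3!apply: addr_ge0 => //.
move=> x Lx xm.
have [k [/andP[z0 zm] kx]] : exists k : nat,
    [/\ (0 <= x + k%:R <= m.+1%:R)%R & (k%:R <= `|x| + 1)%R].
  by apply: order_up => //; rewrite (le_trans xm)// ler_nat.
have [i ik] := action_nat R s k.
apply: (@le_trans _ _ (action_cost D alpha (abs_cost K c h D) (V n) x k%:R)).
  by apply: ereal_inf_lbound; exists i => //; rewrite ik.
have Lz : levels s (x + k%:R)%R by apply: levelsD => //; exact: levels_nat.
apply: (@le_trans _ _ ((K + c * (`|x| + 1))%:E + hb%:E + B%:E)).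
  apply: leeD; first apply: leeD.
  - rewrite lee_fin ger0_norm ?addr_ge0 ?mulr_ge0//.
    by apply: lerD; [case: (0 < _)%R => /=; rewrite ?mulr1 ?mulr0|exact: ler_wpM2l].
  - apply: le_trans (hbar_le_ends (levels_nat R s 0) Lz (levels_nat R s m.+1) _) _.
      by rewrite z0.
    by rewrite /hb EFinD -!hbarE//; [exact: levels_nat|exact: (levels_nat R s 0)].
  - rewrite EFinM; apply: lee_wpmul2l; first by rewrite lee_fin.
    apply: le_trans (mean_after_demand_le C0 Lz zm VC) _.
    by rewrite lee_fin lerD2r ler_wpM2l// lerD2l ger0_norm.
have : (0 <= (K + hb + B) * `|x|)%R.
  by apply: mulr_ge0 => //; do 2!apply: addr_ge0 => //.
by rewrite -!EFinD lee_fin; lra.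
Qed.

Lemma dp_fin n x : levels s x -> V n x \is a fin_num.
Proof.
move=> Lx; have [C _ VC] := dp_growth n (Num.truncn x).+1.
rewrite ge0_fin_numE//; apply: le_lt_trans (VC x Lx _) (ltry _).
exact/ltW/truncnS_gt.
Qed.

Lemma mean_dp_fin n y : levels s y -> mean_after_demand D (V n) y \is a fin_num.
Proof.
move=> Ly; have [C C0 VC] := dp_growth n (Num.truncn y).+1.
rewrite ge0_fin_numE; last exact: mean_after_demand_ge0.
apply: le_lt_trans (mean_after_demand_le C0 Ly _ VC) (ltry _).
exact/ltW/truncnS_gt.
Qed.

Let Vr n x := fine (V n x).
(* Up to the term c y, this is the function G of the optimality equation. *)
Let g n y := (fine (hbar y) + alpha * fine (mean_after_demand D (V n) y))%R.

Lemma action_cost_dpE n x a : levels s (x + a)%R ->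
  action_cost D alpha (abs_cost K c h D) (V n) x a =
  (`|order_cost K c a| + g n (x + a))%:E.
Proof.
move=> Lxa; rewrite /action_cost /abs_cost -/hbar hbarE//.
by rewrite -[mean_after_demand D (V n) _]fineK ?mean_dp_fin// -EFinM -!EFinD addrA.
Qed.

(** Dominated convergence, with a dominating function for each unit
    neighbourhood. *)
Lemma continuous_mean_after_demand (f : R -> R) :
  continuous f -> (forall y, 0 <= f y)%R ->
  (forall x0, exists2 b : T -> R, P.-integrable setT (EFin \o b) &
    forall x w, (x0 - 1 < x < x0 + 1)%R -> (f (x - D 0%N w) <= b w)%R) ->
  continuous (fun y => fine (mean_after_demand D (EFin \o f) y)).
Proof.
move=> cf f0 fb x0; have [b intb fleb] := fb x0.
have mf : measurable_fun [set: R] f by exact: continuous_measurable_fun.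
have fb' x w : `](x0 - 1)%R, (x0 + 1)%R[%classic x -> (`|f (x - D 0%N w)| <= b w)%R.
  by rewrite /= in_itv/= => x01; rewrite ger0_norm//; exact: fleb.
apply: (@continuity_under_integral _ _ _ P (fun x w => f (x - D 0%N w)%R) setT
  measurableT (x0 - 1)%R (x0 + 1)%R _ _ b intb).
- move=> x x01; apply: le_integrable intb => //.
    by apply/measurable_EFinP; exact: measurable_after_demand.
  move=> w _ /=; rewrite lee_fin (le_trans (fb' _ _ x01))//; exact: ler_norm.
- apply: aeW => w _ x _.
  apply: (@continuous_comp _ _ _ (fun x => x - D 0%N w)%R f); last exact: cf.
  by apply: cvgB; [exact: cvg_id|exact: cvg_cst].
- by move=> x x01; apply: aeW => w _; exact: fb'.
- by rewrite inE/= in_itv/=; apply/andP; split; lra.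
Qed.

Section real_levels.
Hypothesis sE : s = RealVersion.

Let Lx (x : R) : levels s x. Proof. by rewrite sE. Qed.

Let h_convexT : convex_on setT h.
Proof. by move: h_convex; rewrite sE. Qed.

Lemma continuous_hbar : continuous (fun y => fine (hbar y)).
Proof.
apply: continuous_mean_after_demand => //; first exact: convex_continuous.
move=> x0; exists (fun w => h (x0 - 1 - D 0%N w) + h (x0 + 1 - D 0%N w))%R.
  have inth y : P.-integrable setT (fun w => (h (y - D 0%N w))%:E).
    apply/integrableP; split; first exact: mhw.
    under eq_integral do rewrite gee0_abs ?lee_fin//.
    exact: h_mean.
  exact: (integrableD measurableT (inth _) (inth _)).
move=> x w /andP[x01 x10].
by apply: (convex_le_ends h_convexT) => //; apply/andP; split; lra.
Qed.

Lemma continuous_post_order n : continuous (Vr n) -> continuous (g n).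
Proof.
move=> cV y; apply: cvgD; first exact: continuous_hbar.
apply: cvgM; first exact: cvg_cst.
have VE : V n = EFin \o Vr n by apply/funext => x /=; rewrite fineK// dp_fin.
rewrite VE; move: y; apply: continuous_mean_after_demand => //.
  by move=> y; apply: fine_ge0.
move=> x0; have [C C0 VC] := dp_growth n (Num.truncn (x0 + 1)).+1.
(* |x - D| <= |x0| + 1 + D when x is within 1 of x0. *)
exists (fun w => C * (2 + `|x0|) + C * D 0%N w)%R.
  apply/integrableP; split.
    apply/measurable_EFinP; apply: measurable_funD => //.
    exact: measurable_funM.
  under eq_integral => w _.
    rewrite gee0_abs; last by rewrite lee_fin !(addr_ge0, mulr_ge0).
    over.
  by rewrite mean_affine// ?mulr_ge0 ?addr_ge0// ltry.
move=> x w /andP[x01 x10].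
have := VC (x - D 0%N w)%R (Lx _).
rewrite -[V n _]fineK ?dp_fin// lee_fin => /(_ _)/le_trans; apply.
  have := truncnS_gt (x0 + 1)%R; have := D_ge0 0%N w; lra.
rewrite -mulrDr ler_wpM2l//.
have [xge0|xlt0] := leP 0%R x; have := D_ge0 0%N w.
  have := ler_norm x0; have := ler_normB x (D 0%N w).
  by rewrite [`|x|%R]ger0_norm// [`|D _ _|%R]ger0_norm//; lra.
have := ler_norm (- x0); have := ler_normB x (D 0%N w); rewrite normrN.
by rewrite [`|x|%R]ltr0_norm// => + + D0; rewrite [`|D _ _|%R]ger0_norm//; lra.
Qed.

Let order_costE (a : R) : (0 <= a)%R ->
  `|order_cost K c a|%R = (K * (0 < a)%R%:R + c * a)%R.
Proof. by move=> a0; rewrite ger0_norm// addr_ge0// mulr_ge0. Qed.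

(** If a real order [a > 0] beat every order of the enumeration, then by
    continuity so would an order of the enumeration slightly larger than [a].
    The order 0, where the cost jumps, is itself in the enumeration. *)
Lemma bellman_real n x a : continuous (g n) -> (0 <= a)%R ->
  V n.+1 x <= action_cost D alpha (abs_cost K c h D) (V n) x a.
Proof.
move=> cg; rewrite le_eqVlt => /predU1P[<-|a0].
  have [k k0] := action_nat R s 0.
  by apply: ereal_inf_lbound; exists k => //; rewrite k0.
rewrite action_cost_dpE// leNgt -[V _ _]fineK ?dp_fin// lte_fin.
rewrite order_costE ?ltW// a0 mulr1; apply/negP => lt_a.
pose F b := (K + c * b + g n (x + b))%R.
have cF : F b @[b --> a] --> F a.
  apply: cvgD.
    by apply: cvgD; [exact: cvg_cst|apply: cvgM; [exact: cvg_cst|exact: cvg_id]].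
  apply: (@continuous_comp _ _ _ (fun b => x + b)%R (g n)); last exact: cg.
  by apply: cvgD; [exact: cvg_cst|exact: cvg_id].
have [r /= r0 near_a] := cvgr_lt _ cF _ lt_a.
have [k /andP[ak ka]] : exists k, (a < action R RealVersion k < a + r)%R.
  by apply: action_dense; rewrite ltW//= ltrDl.
have aq : (`|a - action R RealVersion k| < r)%R.
  by rewrite ltr_distl; apply/andP; split; lra.
have := near_a _ aq; apply/negP.
rewrite -leNgt -lee_fin (fineK (dp_fin n.+1 (Lx x))).
rewrite /F (_ : K + _ = `|order_cost K c (action R RealVersion k)|)%R; last first.
  by rewrite order_costE ?orders_ge0 ?(lt_trans a0 ak) ?mulr1// ltW// (lt_trans a0).
rewrite -action_cost_dpE// -sE.
by apply: ereal_inf_lbound; exists k.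
Qed.

(** Adding [c * x] to [dp] removes the proportional cost from the infimum and
    leaves the form of [continuous_inf_order]. *)
Lemma continuous_dp n : continuous (Vr n).
Proof.
elim: n => [|n IH]; first exact: cst_continuous.
have cg := continuous_post_order IH.
pose W x := (Vr n.+1 x + c * x)%R.
have cW : continuous W.
  apply: (@continuous_inf_order R K (fun y => g n y + c * y)%R) => //.
  - by move=> y; apply: cvgD; [exact: cg|apply: cvgM; [exact: cvg_cst|exact: cvg_id]].
  - move=> x a a0; have := bellman_real x cg a0.
    rewrite action_cost_dpE// -[V _ _]fineK ?dp_fin// lee_fin order_costE//.
    by rewrite /W /Vr; lra.
  - move=> x e e0.
    have [_ [k _ <-]] := lb_ereal_inf_adherent e0 (dp_fin n.+1 (Lx x)).
    have ak := orders_ge0 (orders_action R s k).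
    rewrite -/(V n) action_cost_dpE// order_costE//.
    rewrite -[X in _ < X + _]/(V n.+1 x) -[V n.+1 x]fineK ?dp_fin// -EFinD lte_fin => kV.
    by exists (action R s k) => //; rewrite /W /Vr; lra.
have -> : Vr n.+1 = (fun x => W x - c * x)%R by apply/funext => x; rewrite /W addrK.
by move=> x; apply: cvgB; [exact: cW|apply: cvgM; [exact: cvg_cst|exact: cvg_id]].
Qed.

End real_levels.

Lemma bellman n x a : orders s a ->
  V n.+1 x <= action_cost D alpha (abs_cost K c h D) (V n) x a.
Proof.
case sE : s => oa.
  apply: bellman_real => //.
  by apply: continuous_post_order => //; exact: continuous_dp.
have [k _ <-] : range (action R s) a.
  by move: oa; rewrite sE => -[k _ <-]; exists k.
by apply: ereal_inf_lbound; exists k.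
Qed.

Lemma value_dp n : value s K c h D n alpha = V n.
Proof.
apply/funext => x; rewrite /value.
under eq_fun do rewrite policy_valueE//.
apply: inf_total_dp => //; [exact: measurable_abs_cost| |].
- by move=> y a; exact: abs_cost_ge0.
- by move=> m y a; exact: bellman.
Qed.

Lemma G_dp n x : levels s x ->
  G s K c h D n alpha x = (c * x + g n x)%:E.
Proof.
move=> Lx; rewrite /G value_dp.
rewrite [X in _ + _ * X](_ : _ = mean_after_demand D (V n) x); last first.
  by rewrite integral_demand// integral_demand_law// mean_after_demandE.
rewrite unlock -[X in _ + X + _]/(hbar x) hbarE//.
by rewrite -[mean_after_demand D (V n) _]fineK ?mean_dp_fin// -EFinM -!EFinD addrA.
Qed.

Lemma continuous_G n : s = RealVersion ->
  continuous (fine \o G s K c h D n alpha).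
Proof.
move=> sE.
rewrite (_ : _ \o _ = (fun x => c * x + g n x)%R).
  move=> x; apply: cvgD; first by apply: cvgM; [exact: cvg_cst|exact: cvg_id].
  by apply: continuous_post_order => //; exact: continuous_dp.
by apply/funext => x /=; rewrite G_dp// sE.
Qed.

End model.

Local Close Scope ereal_scope.

Theorem theorem5p2 (d : measure_display) (T : measurableType d) (R : realType)
    (P : probability T R) (s : version) (K c : R) (h : R -> R)
    (D : nat -> {RV P >-> R}) (alpha : R)
    (K_gt0 : 0 < K) (c_gt0 : 0 < c)
    (h_off : forall x, ~ levels s x -> h x = 0)
    (h_ge0 : forall x, levels s x -> 0 <= h x)
    (h_convex : convex_on (levels s) h)
    (h0 : h 0 = 0)
    (h_pinfty : h x @[x --> within (levels s) +oo] --> +oo)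
    (h_ninfty : h x @[x --> within (levels s) -oo] --> +oo)
    (D_iid : iid D)
    (D_ge0 : forall t w, 0 <= D t w)
    (D_levels : forall t w, levels s (D t w))
    (D_mean : ('E_P[D 0%N] < +oo)%E)
    (D_pos : (0 < P [set w | (0 < D 0%N w)%R])%E)
    (h_mean : forall x, levels s x -> ('E_P[fun w => h (x - D 0%N w)%R] < +oo)%E)
    (alpha_ge0 : 0 <= alpha) (t : nat) :
  [/\ forall x, levels s x -> value s K c h D t alpha x \is a fin_num,
      {within levels s, continuous (fine \o value s K c h D t alpha)},
      forall x, levels s x -> G s K c h D t alpha x \is a fin_num &
      {within levels s, continuous (fine \o G s K c h D t alpha)}].
Proof.
have h_nneg x : 0 <= h x.
  by have [/h_ge0//|/h_off ->] := pselect (levels s x).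
have mh : measurable_fun setT h.
  case sE : s; last exact: measurable_off_levels sE h_off.
  apply: continuous_measurable_fun; apply: convex_continuous => //.
  by move: h_convex; rewrite sE.
have hbar_lty x : levels s x -> (mean_after_demand D (EFin \o h) x < +oo)%E.
  by move=> /h_mean; rewrite unlock.
have [K_ge0 c_ge0] := (ltW K_gt0, ltW c_gt0).
have within f : (s = RealVersion -> continuous f) ->
    {within levels s, continuous (f : R -> R)}.
  case sE : s => cf; last exact: continuous_integer_levels.
  exact/continuous_subspaceT/cf.
split.
- by move=> x Lx; rewrite value_dp//; exact: dp_fin.
- apply: within => sE; rewrite value_dp//; exact: continuous_dp.
- by move=> x Lx; rewrite G_dp.
- by apply: within => sE; exact: continuous_G.
Qed.
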